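(* Let $c\in\mathbb R$, let $U\subset\mathbb R^2$ be a domain, and let $f:U\to M^3_1(c)$ be a time-like immersion with constant mean curvature. If $p\in U$ is an isolated umbilic of $f$, then $p$ is an accumulation point of the set of quasi-umbilics of $f$.
   Context: All maps are $C^\infty$ unless stated otherwise. $M^3_1(c)$ denotes the Lorentzian 3-dimensional space form of signature $(++-)$ and constant sectional curvature $c$: the Lorentz-Minkowski space $\mathbb R^3_1$ if $c=0$; the de Sitter 3-space $\{x\in\mathbb R^4_1:\langle x,x\rangle=1/c\}$ if $c>0$; the anti-de Sitter 3-space $\{x\in\mathbb R^4_2:\langle x,x\rangle=1/c\}$ if $c<0$ (here $\mathbb R^4_1$, $\mathbb R^4_2$ have signatures $(+++-)$, $(++--)$). An immersion is time-like if its induced metric (first fundamental form) is Lorentzian. The principal curvatures of $f$ at a point are the two (possibly non-real, possibly coinciding) eigenvalues of the shape operator; the mean curvature is half of its trace. A point $p\in U$ is an umbilic of $f$ if the shape operator at $p$ is a scalar multiple of the identity. A point $p$ is a quasi-umbilic if it is not an umbilic but the two principal curvatures coincide at $p$. An umbilic or quasi-umbilic $p$ is admissible if there is a neighborhood $U_1\subset U$ of $p$ on which the principal curvatures of $f$ are real-valued. An umbilic $p$ is isolated if it is admissible and the neighborhood $U_1$ can be chosen so that it contains no umbilics other than $p$. *)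

(* Defs.v *)
From mathcomp Require Import all_boot all_order all_algebra.
From mathcomp Require Import all_classical all_reals all_analysis.
From mathcomp Require Import complex.

Set Implicit Arguments.
Unset Strict Implicit.
Unset Printing Implicit Defensive.

Import Order.TTheory GRing.Theory Num.Theory.
Import numFieldNormedType.Exports.

Local Open Scope classical_set_scope.
Local Open Scope complex_scope.
Local Open Scope ring_scope.

(* [Ck k D f]: f is of class C^k on D.  Meant for open D, where only the values
   of the total function f on D matter. *)
Fixpoint Ck (R : realType) (V W : normedModType R) (k : nat)
    (D : set V) (f : V -> W) : Prop :=
  match k with
  | 0%N => forall x, D x -> {for x, continuous f}
  | k'.+1 => (forall x, D x -> differentiable f x) /\
             (forall v : V, Ck k' D ('D_v f))
  end.

Definition smooth (R : realType) (V W : normedModType R)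
    (D : set V) (f : V -> W) : Prop := forall k, Ck k D f.

Section SpaceForm.
Variables (R : realType) (c : R).

Definition ambient_dim : nat := if c == 0 then 3 else 4.

(* Signature (++-) if c = 0, (+++-) if c > 0 and (++--) if c < 0. *)
Definition ambient_sign (i : 'I_ambient_dim) : R :=
  if (i < (if (0 < c)%R then 3 else 2))%N then 1 else - 1.

Definition inner (x y : 'rV[R]_ambient_dim) : R :=
  \sum_i ambient_sign i * x ord0 i * y ord0 i.

Definition space_form : set 'rV[R]_ambient_dim :=
  [set x | c != 0 -> inner x x = c^-1].

End SpaceForm.

Arguments space_form {R} c.

Section Surface.
Variables (R : realType) (c : R).

Let E := 'rV[R]_(ambient_dim c).

Definition pd (f : 'rV[R]_2 -> E) (i : 'I_2) : 'rV[R]_2 -> E :=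
  'D_(delta_mx ord0 i) f.

Definition first_form (f : 'rV[R]_2 -> E) (x : 'rV[R]_2) : 'M[R]_2 :=
  \matrix_(i, j) inner (pd f i x) (pd f j x).

(* A Lorentzian inner product on a plane: signature (+-). *)
Definition lorentzian (A : 'M[R]_2) : Prop :=
  exists2 P : 'M[R]_2, P \in unitmx &
    P *m A *m P^T = \matrix_(i, j) (if i != j then 0
                                    else if i == ord0 then 1 else - 1).

Definition timelike_immersion (U : set 'rV[R]_2) (f : 'rV[R]_2 -> E) : Prop :=
  [/\ smooth U f,
      f @` U `<=` space_form c,
      forall x, U x -> injective ('d f x) &
      forall x, U x -> lorentzian (first_form f x)].

(* When c != 0 the tangent space of the space form at y is the orthogonal
   complement of y in the ambient space, whence the last clause. *)
Definition unit_normal (U : set 'rV[R]_2) (f nu : 'rV[R]_2 -> E) : Prop :=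
  smooth U nu /\
  forall x, U x ->
    [/\ inner (nu x) (nu x) = 1,
        forall v, inner ('d f x v) (nu x) = 0 &
        c != 0 -> inner (f x) (nu x) = 0].

(* Since nu is orthogonal to both f and df, the Levi-Civita derivative of nu in
   the space form is its derivative in the flat ambient space, so
   df (S v) = - D_v nu, i.e. I (S v, w) = - < D_v nu, D_w f >.
   The matrix acts on row vectors: S v = v *m shape_operator. *)
Definition shape_operator (f nu : 'rV[R]_2 -> E) (x : 'rV[R]_2) : 'M[R]_2 :=
  (\matrix_(i, j) - inner (pd nu i x) (pd f j x)) *m invmx (first_form f x).

Definition mean_curvature (f nu : 'rV[R]_2 -> E) (x : 'rV[R]_2) : R :=
  \tr (shape_operator f nu x) / 2.

Definition principal_curvature (f nu : 'rV[R]_2 -> E) (x : 'rV[R]_2)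
    (k : R[i]) : bool :=
  eigenvalue (map_mx (real_complex R) (shape_operator f nu x)) k.

Definition real_principal_curvatures (f nu : 'rV[R]_2 -> E)
    (x : 'rV[R]_2) : Prop :=
  forall k, principal_curvature f nu x k -> exists r : R, k = r%:C.

Definition umbilic (f nu : 'rV[R]_2 -> E) (x : 'rV[R]_2) : Prop :=
  exists a : R, shape_operator f nu x = a%:M.

Definition quasi_umbilic (f nu : 'rV[R]_2 -> E) (x : 'rV[R]_2) : Prop :=
  ~ umbilic f nu x /\
  forall k1 k2, principal_curvature f nu x k1 ->
                principal_curvature f nu x k2 -> k1 = k2.

Definition isolated_umbilic (U : set 'rV[R]_2) (f nu : 'rV[R]_2 -> E)
    (p : 'rV[R]_2) : Prop :=
  umbilic f nu p /\
  exists U1 : set 'rV[R]_2,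
    [/\ nbhs p U1, U1 `<=` U,
        forall x, U1 x -> real_principal_curvatures f nu x &
        forall x, U1 x -> umbilic f nu x -> x = p].

End Surface.

(* Main.v *)
Require Import Defs.
From mathcomp Require Import all_boot all_order all_algebra.
From mathcomp Require Import all_classical all_reals all_analysis.
From mathcomp Require Import ring lra.
From mathcomp Require Import complex.
Import Order.TTheory GRing.Theory Num.Theory.
Import numFieldNormedType.Exports.
Local Open Scope classical_set_scope.
Local Open Scope ring_scope.

(** Let H be the constant mean curvature and M_v = D_v nu + H D_v f; since f has
    mean curvature H, the symmetric form (v, w) |-> < M_v, D_w f > is trace free
    for the first fundamental form.  A time-like metric has two fields X, Y of
    null directions, and a trace-free form vanishes on (X, Y): it is given by the
    two functions q = < M_X, D_X f > and r = < M_Y, D_Y f >.  The determinant of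
    the shape operator is H ^ 2 minus a multiple of q r, so that the principal
    curvatures coincide wherever q = 0, and such a point is an umbilic or a
    quasi-umbilic (null_frame).

    The Codazzi equation for a surface of constant mean curvature says that, in
    null coordinates, q is a function of one coordinate alone.  Coordinate-free,
    D_Y q = a q for a continuous function a (codazzi).  At an umbilic q = 0, hence
    q vanishes on the whole integral curve of Y through it; the points of this
    curve near an isolated umbilic are therefore quasi-umbilics.

    Zeros of q close to p and distinct from p are found without integrating Y:
    one minimises q ^ 2 plus a small affine function on a cone that the field Y
    enters through its base and crosses towards its apex p (zeros_cluster).  The differential inequality forbids a
    minimum outside the base, so that q ^ 2 is arbitrarily small on the base and
    has a zero there.

    The fields X, Y are explicit: if e1, e2 are null at p, and E, F, G are the
    coefficients of the first fundamental form in the basis (e1, e2), then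
    X = u e1 - E e2 and Y = u e2 - G e1, with u = F + sqrt (F ^ 2 - E G), are null
    at every point near p. *)

(** * Zeros of a function that obeys a differential inequality *)

Section Toolkit.
Context {R : realType} {V : normedModType R}.
Implicit Types (f g : V -> R) (x v : V).

Lemma contD f g x : {for x, continuous f} -> {for x, continuous g} ->
  {for x, continuous (fun z => f z + g z)}.
Proof. exact: continuousD. Qed.
Lemma contB f g x : {for x, continuous f} -> {for x, continuous g} ->
  {for x, continuous (fun z => f z - g z)}.
Proof. exact: continuousB. Qed.
Lemma contM f g x : {for x, continuous f} -> {for x, continuous g} ->
  {for x, continuous (fun z => f z * g z)}.
Proof. exact: continuousM. Qed.
End Toolkit.

(** Consider the cone K = { s <= d, |p - z| <= N s }, where s z = l (p - z).
    Moving backwards along Y increases s, at a rate that keeps z in K until s = d.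
    Suppose that q ^ 2 - eta s has its minimum over K at z.  The value at p is 0, so
    q ^ 2 <= eta s <= eta d at z.  If s z < d, the derivative of q ^ 2 - eta s along
    Y at z is at least eta m - 2 |A| q ^ 2, which is positive for small d, and a
    small step backwards decreases the function.  Hence s z = d.  As eta is
    arbitrary, q ^ 2 is arbitrarily small on the compact base s = d of the cone, and
    q vanishes somewhere on this base, which does not contain p. *)
Lemma zeros_cluster (R : realType) (V : normedModType R) (l : {linear V -> R})
    (q : V -> R) (Y : V -> V) (p : V) (A : R) :
  (forall K : set V, bounded_set K -> closed K -> compact K) ->
  continuous l -> {for p, continuous Y} -> 0 < l (Y p) -> q p = 0 ->
  (\forall z \near p, {for z, continuous q}) ->
  (\forall z \near p, derivable q z (Y z)) ->
  (\forall z \near p, `|'D_(Y z) q z| <= A * `|q z|) ->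
  limit_point [set z | q z = 0] p.
Proof.
move=> HB lc Yc lYp qp0 cq dq qA W pW.
pose m := l (Y p) / 2.
have m0 : 0 < m by rewrite divr_gt0.
pose M := `|Y p| + 1.
have M0 : 0 < M by rewrite ltr_wpDl.
pose N : R := M / m.
have N0 : 0 < N by rewrite divr_gt0.
have near_good : \forall z \near p, [/\ m <= l (Y z), `|Y z| <= M,
    {for z, continuous q} /\ derivable q z (Y z),
    `|'D_(Y z) q z| <= A * `|q z| & W z].
  near=> z; split.
  - near: z; apply: (@cvgr_ge _ _ _ _ _ (l (Y p))).
      by apply: continuous_comp; [exact: Yc|exact: lc].
    by rewrite /m ltr_pdivrMr// ltr_pMr// ltr1n.
  - near: z; apply: (@cvgr_norm_le _ _ _ _ _ _ (Y p)); first exact: Yc.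
    by rewrite /M ltrDl.
  - by split; near: z.
  - by near: z.
  - by near: z.
have [e /= e0 good] := (nbhs_ballP _ _).1 near_good.
pose B : R := `|A| + 1.
have B0 : 0 < B by rewrite ltr_wpDl.
have AB : A <= B by rewrite (le_trans (ler_norm A))// lerDl.
(* The first bound on d keeps the cone in the ball, the second one makes
   2 B (eta d) smaller than eta m. *)
have [d [d0 dN dB]] : exists d, [/\ 0 < d, N * d < e & 2 * B * d < m].
  pose d := Num.min (e / (2 * N)) (m / (4 * B)).
  have d0 : 0 < d.
    by rewrite lt_min; apply/andP; split; apply: divr_gt0 => //; apply: mulr_gt0.
  have dN : d * (2 * N) <= e.
    by rewrite -ler_pdivlMr; [rewrite ge_min lexx|apply: mulr_gt0].
  have dB : d * (4 * B) <= m.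
    by rewrite -ler_pdivlMr; [rewrite ge_min lexx orbT|apply: mulr_gt0].
  by exists d; split => //; clearbody d N; lra.
pose s z := l (p - z).
have idc (z : V) : {for z, continuous (fun y : V => p - y)}.
  by apply: (@continuousB _ _ _ (cst p) id); [exact: cst_continuous|exact: cvg_id].
have sc z : {for z, continuous s}.
  by apply: continuous_comp; [exact: idc|exact: lc].
have nc z : {for z, continuous (fun y : V => `|p - y|)}.
  by apply: continuous_comp; [exact: idc|exact: norm_continuous].
pose K := [set z | s z <= d /\ `|p - z| <= N * s z].
have sK z : K z -> 0 <= s z.
  move=> [_ h]; have := le_trans (normr_ge0 _) h.
  by rewrite pmulr_rge0.
have goodK z : K z -> [/\ m <= l (Y z), `|Y z| <= M,
    {for z, continuous q} /\ derivable q z (Y z),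
    `|'D_(Y z) q z| <= A * `|q z| & W z].
  move=> [h1 h2]; apply: good; rewrite -ball_normE /=.
  apply: le_lt_trans dN; apply: le_trans h2 _.
  by rewrite ler_pM2l.
have closedL (f : V -> R) r : (forall z, {for z, continuous f}) ->
    closed [set z | f z <= r].
  move=> fc; apply: (closed_comp (D := [set x | x <= r])) (@closed_le _ r).
  by move=> z _; exact: fc.
have Kclosed : closed K.
  rewrite (_ : K = [set z | s z <= d] `&` [set z | `|p - z| - N * s z <= 0]).
    apply: closedI; apply: closedL => // z.
    by apply: contB => //; apply: contM => //; exact: cst_continuous.
  by apply/seteqP; split => z /=; rewrite subr_le0.
have Kcompact : compact K.
  apply: HB Kclosed.
  exists (e + `|p|); split; first exact: num_real.
  move=> x ex z [h1 h2] /=; rewrite -(subrK p z) (le_trans (ler_normD _ _))//.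
  apply: le_trans (ltW ex); rewrite lerD2r distrC.
  by apply: le_trans (ltW dN); apply: le_trans h2 _; rewrite ler_pM2l.
have sp : s p = 0 by rewrite /s subrr raddf0.
have Kp : K p by rewrite /K /= sp subrr normr0 mulr0 lexx ltW.
have qc z : K z -> {for z, continuous q}.
  by move=> /goodK[_ _ [h _] _ _].
pose w z := q z * q z.
have wc z : K z -> {for z, continuous w}.
  by move=> Kz; apply: contM; exact: qc.
have bottom eta : 0 < eta -> exists z, [/\ K z, s z = d & w z <= eta * d].
  move=> eta0; pose g z := w z - eta * s z.
  have [z zK gmin] : exists2 z, z \in K & forall t, t \in K -> g z <= g t.
    apply: compact_EVT_min => //; first by exists p.
    apply: continuous_in_subspaceT => z; rewrite inE => Kz.
    by apply: contB; [exact: wc|apply: contM => //; exact: cst_continuous].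
  rewrite inE in zK.
  have [lY YM [_ dqz] qAz _] := goodK _ zK.
  have gz : w z <= eta * s z.
    have := gmin p; rewrite inE => /(_ Kp).
    by rewrite /g {2}/w qp0 mul0r sp mulr0 subr0 subr_le0.
  have szd : s z <= d by case: zK.
  exists z; split => //; last first.
    by rewrite (le_trans gz)// ler_pM2l.
  apply/eqP; rewrite eq_le szd leNgt; apply/negP => {}szd.
  have sD h : s (h *: Y z + z) = s z - h * l (Y z).
    by rewrite /s !raddfB /= raddfD /= linearZ /= -[h *: _]/(h * _); ring.
  have slope : - (eta * l (Y z)) < q z * 'D_(Y z) q z + q z * 'D_(Y z) q z.
    have qs : `|q z| * `|q z| <= eta * s z.
      by rewrite -normrM ger0_norm// sqr_ge0.
    have qD : - (q z * 'D_(Y z) q z) <= `|q z| * (B * `|q z|).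
      rewrite (le_trans (ler_norm _))// normrN normrM ler_wpM2l//.
      by rewrite (le_trans qAz)// ler_wpM2r.
    have qB : `|q z| * (B * `|q z|) <= B * (eta * d).
      by rewrite mulrCA ler_pM2l// (le_trans qs)// ler_pM2l// ltW.
    have lm : eta * m <= eta * l (Y z) by rewrite ler_pM2l.
    have : eta * (2 * B * d) < eta * m by rewrite ltr_pM2l.
    lra.
  have dw : is_derive z (Y z) w (q z * 'D_(Y z) q z + q z * 'D_(Y z) q z).
    have dq' : is_derive z (Y z) q ('D_(Y z) q z).
      exact: derivableP.
    exact: is_deriveM.
  have near_slope : \forall h \near 0^',
      - (eta * l (Y z)) < h^-1 * (w (h *: Y z + z) - w z).
    apply: (@cvgr_gt _ _ _ _ _ ('D_(Y z) w z)); last by rewrite derive_val.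
    exact: (@ex_derive _ _ _ _ _ _ _ dw).
  have l0 : 0 < l (Y z) by exact: lt_le_trans lY.
  have ds0 : 0 < (d - s z) / l (Y z) by apply: divr_gt0 => //; rewrite subr_gt0.
  near (0 : R)^'- => h.
  have h0 : h < 0 by near: h; exact: nbhs_left_lt.
  have hd : - h * l (Y z) <= d - s z.
    rewrite -ler_pdivlMr// lerNl ltW//; near: h; apply: nbhs_left_gt.
    by rewrite oppr_lt0.
  have : h *: Y z + z \in K.
    rewrite inE; split; rewrite sD; first lra.
    have -> : p - (h *: Y z + z) = (p - z) - h *: Y z by rewrite opprD addrA addrAC.
    apply: le_trans (ler_normB _ _) _; rewrite normrZ ltr0_norm//.
    have [_ pz] := zK.
    have : - h * `|Y z| <= - h * (N * l (Y z)).
      rewrite ler_pM2l ?oppr_gt0// (le_trans YM)//.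
      by rewrite /N mulrAC ler_pdivlMr// ler_pM2l.
    lra.
  move=> /gmin; apply/negP; rewrite -ltNge /g sD.
  have : - (eta * l (Y z)) < h^-1 * (w (h *: Y z + z) - w z).
    near: h; rewrite near_withinE; move: near_slope; rewrite near_withinE.
    by apply: filterS => h Ph h0; apply: Ph; rewrite lt_eqF.
  rewrite [h^-1 * _]mulrC ltr_ndivlMr//.
  lra.
(* The base is not empty: take any eta. *)
have [z0 [Kz0 sz0 _]] := bottom 1 ltr01.
pose K' := K `&` [set z | d <= s z].
have [z zK' wmin] : exists2 z, z \in K' & forall t, t \in K' -> w z <= w t.
  apply: compact_EVT_min; first by exists z0; split => //=; rewrite sz0.
    apply: compact_closedI => //.
    rewrite (_ : mkset _ = [set z | 0 - s z <= - d]).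
      by apply: closedL => z; apply: contB => //; exact: cst_continuous.
    by apply/seteqP; split => z /=; rewrite sub0r lerN2.
  apply: continuous_in_subspaceT => z; rewrite inE => -[Kz _].
  exact: wc.
rewrite inE in zK'; case: zK' => Kz dz.
exists z; split.
- by apply/eqP => zp; move: dz; rewrite /= zp sp leNgt d0.
- rewrite /=; apply/eqP; rewrite -[_ == _]orbb -mulf_eq0 -/(w z).
  rewrite eq_le sqr_ge0 andbT leNgt; apply/negP => wz0.
  have [|z1 [Kz1 sz1 wz1]] := bottom (w z / (2 * d)).
    by apply: divr_gt0 => //; apply: mulr_gt0.
  have := wmin z1; rewrite inE => /(_ (conj Kz1 _)).
  rewrite /= sz1 lexx => /(_ isT); apply/negP; rewrite -ltNge.
  apply: le_lt_trans wz1 _.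
  by rewrite invfM mulrA mulfVK ?gt_eqF// ltr_pdivrMr// ltr_pMr// ltr1n.
- by have [] := goodK _ Kz.
Unshelve. all: by end_near.
Qed.

(** * Derivatives of vector-valued functions and of the inner product *)

Section VectorCalculus.
Context {R : realType} {V : normedModType R}.

Lemma is_derive_coord m (f : V -> 'rV[R]_m) (z v : V) (df : 'rV[R]_m) :
  is_derive z v f df <-> forall i, is_derive z v (fun y => f y ord0 i) (df ord0 i).
Proof.
split=> [h i|h].
  have fd : derivable f z v by exact: (@ex_derive _ _ _ _ _ _ _ h).
  apply: DeriveDef; first exact: (derivable_mxP _ _ _).1.
  by rewrite -[in RHS](@derive_val _ _ _ _ _ _ _ h) derive_mx// mxE.
have fd : derivable f z v.
  apply/derivable_mxP => i j; rewrite ord1.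
  exact: (@ex_derive _ _ _ _ _ _ _ (h j)).
apply: DeriveDef => //; rewrite derive_mx//; apply/matrixP => i j.
by rewrite mxE !ord1; exact: (@derive_val _ _ _ _ _ _ _ (h j)).
Qed.

Lemma derivable_is_derive (W : normedModType R) (f : V -> W) z v :
  differentiable f z -> is_derive z v f ('D_v f z).
Proof. by move=> /diff_derivable h; apply: derivableP. Qed.

Lemma is_derive_scale m (k : V -> R) (f : V -> 'rV[R]_m) (z v : V) dk df :
  is_derive z v k dk -> is_derive z v f df ->
  is_derive z v (fun y => k y *: f y) (dk *: f z + k z *: df).
Proof.
move=> hk /is_derive_coord hf; apply/is_derive_coord => i.
have -> : (fun y => (k y *: f y) ord0 i) = k * (fun y => f y ord0 i).
  by apply/funext => y; rewrite mxE.
by apply: is_derive_eq; rewrite !mxE addrC [_ *: dk]mulrC.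
Qed.

Lemma is_derive_add (W : normedModType R) (f g : V -> W) (z v : V) df dg :
  is_derive z v f df -> is_derive z v g dg ->
  is_derive z v (fun y => f y + g y) (df + dg).
Proof. exact: is_deriveD. Qed.

Lemma derive_lin (W : normedModType R) (f : V -> W) (z u v : V) (a b : R) :
  differentiable f z -> 'D_(a *: u + b *: v) f z = a *: 'D_u f z + b *: 'D_v f z.
Proof. by move=> df; rewrite !deriveE// linearD !linearZ. Qed.

Lemma differentiable_component m (f : V -> 'rV[R]_m) z i :
  differentiable f z -> differentiable (fun y => f y ord0 i) z.
Proof.
move=> df; apply: (@differentiable_comp _ _ _ _ f (fun N : 'rV[R]_m => N ord0 i)) => //.
exact: differentiable_coord.
Qed.

Lemma continuous_component m (f : V -> 'rV[R]_m) z i :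
  {for z, continuous f} -> {for z, continuous (fun y => f y ord0 i)}.
Proof.
move=> cf; apply: (@continuous_comp _ _ _ f (fun N : 'rV[R]_m => N ord0 i)) => //.
exact: coord_continuous.
Qed.

End VectorCalculus.

Section InnerCalculus.
Context {R : realType} {c : R} {V : normedModType R}.
Local Notation E := 'rV[R]_(ambient_dim c).

Lemma innerC (x y : E) : inner x y = inner y x.
Proof. by apply: eq_bigr => i _; rewrite -!mulrA; congr (_ * _); rewrite mulrC. Qed.

Lemma innerDl (x y w : E) : inner (x + y) w = inner x w + inner y w.
Proof.
rewrite /inner -big_split; apply: eq_bigr => i _ /=.
by rewrite !mxE mulrDr mulrDl.
Qed.

Lemma innerZl a (x w : E) : inner (a *: x) w = a * inner x w.
Proof.
by rewrite /inner mulr_sumr; apply: eq_bigr => i _; rewrite !mxE mulrCA !mulrA.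
Qed.

Lemma innerDr (x y w : E) : inner w (x + y) = inner w x + inner w y.
Proof. by rewrite !(innerC w) innerDl. Qed.

Lemma innerZr a (x w : E) : inner w (a *: x) = a * inner w x.
Proof. by rewrite !(innerC w) innerZl. Qed.

Definition innerE := (innerDl, innerDr, innerZl, innerZr).

Lemma is_derive_inner (f g : V -> E) (z v : V) df dg :
  is_derive z v f df -> is_derive z v g dg ->
  is_derive z v (fun y => inner (f y) (g y)) (inner df (g z) + inner (f z) dg).
Proof.
move=> /is_derive_coord hf /is_derive_coord hg.
have -> : (fun y => inner (f y) (g y)) = \sum_i (ambient_sign i *:
    ((fun y => f y ord0 i) * (fun y => g y ord0 i))).
  apply/funext => y; rewrite fct_sumE; apply: eq_bigr => i _ /=.
  by rewrite -mulrA.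
apply: is_derive_eq.
rewrite /inner -big_split; apply: eq_bigr => i _ /=.
rewrite -[_ *: (_ + _)]/(_ * (_ + _)) -[_ *: dg _ _]/(_ * _) -[_ *: df _ _]/(_ * _).
ring.
Qed.

Lemma differentiable_inner (f g : V -> E) (z : V) :
  differentiable f z -> differentiable g z ->
  differentiable (fun y => inner (f y) (g y)) z.
Proof.
move=> hf hg.
have -> : (fun y => inner (f y) (g y)) = \sum_i (ambient_sign i *:
    ((fun y => f y ord0 i) * (fun y => g y ord0 i))).
  apply/funext => y; rewrite fct_sumE; apply: eq_bigr => i _ /=.
  by rewrite -mulrA.
apply: differentiable_sum => i; apply: differentiableZ.
by apply: differentiableM; exact: differentiable_component.
Qed.

Lemma continuous_inner (f g : V -> E) (z : V) :
  {for z, continuous f} -> {for z, continuous g} ->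
  {for z, continuous (fun y => inner (f y) (g y))}.
Proof.
move=> hf hg.
have -> : (fun y => inner (f y) (g y)) = (fun y => \sum_i (ambient_sign i *
    f y ord0 i * g y ord0 i)) by [].
have h i : {for z, continuous (fun y => ambient_sign i * f y ord0 i * g y ord0 i)}.
  apply: continuousM; last exact: continuous_component.
  apply: continuousM; first exact: cst_continuous.
  exact: continuous_component.
have -> : (fun y => \sum_i (ambient_sign i * f y ord0 i * g y ord0 i)) =
  \sum_i (fun y => ambient_sign i * f y ord0 i * g y ord0 i).
  by apply/funext => y; rewrite fct_sumE.
by elim/big_ind : _ => // [|k1 k2]; [exact: cst_continuous|exact: continuousD].
Qed.

End InnerCalculus.

(** * Symmetry of second derivatives *)

Lemma far_apart (R : realType) (e x y w w' : R) :
  `|x - w| < e -> `|y - w'| < e -> `|x - y| = e + e -> w <> w'.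
Proof.
move=> + + xy ww; rewrite ww => xw yw.
by have := ler_distD w' x y; rewrite (distrC w' y); lra.
Qed.

Section Schwarz.
Context {R : realType} {V : normedModType R}.

Lemma is_derive_line (W : normedModType R) (g : V -> W) (y w : V) (a : R) :
  differentiable g (y + a *: w) ->
  is_derive a 1 (fun s : R => g (y + s *: w)) ('D_w g (y + a *: w)).
Proof.
move=> dg; have := @diff_derivable _ _ _ g (y + a *: w) w dg.
have E : (fun h : R => h^-1 *: (((fun s : R => g (y + s *: w)) \o shift a) (h *: 1)
    - g (y + a *: w))) =
  (fun h => h^-1 *: ((g \o shift (y + a *: w)) (h *: w) - g (y + a *: w))).
  apply/funext => h /=; congr (_ *: (g _ - _)).
  by rewrite [h *: 1]mulr1 scalerDl addrCA.
by move=> dw; apply: DeriveDef; rewrite /derivable /derive E.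
Qed.

(** The mean value theorem, first in the direction u and then in the
    direction v; applied with u and v exchanged it expresses the same second
    difference by the derivative taken in the other order. *)
Lemma mixed_difference m (g : V -> 'rV[R]_m) i (z u v : V) (t : R) : 0 < t ->
  (forall a b, 0 <= a <= t -> 0 <= b <= t ->
    differentiable g (z + a *: u + b *: v) /\
    differentiable ('D_u g) (z + a *: u + b *: v)) ->
  let gi y := g y ord0 i in
  exists a b, [/\ 0 <= a <= t, 0 <= b <= t &
    gi (z + t *: u + t *: v) - gi (z + t *: u) - (gi (z + t *: v) - gi z) =
    'D_v ('D_u g) (z + a *: u + b *: v) ord0 i * t * t].
Proof.
move=> t0 dg gi.
have tt : 0 <= t <= t by rewrite ltW/=.
have zt : 0 <= (0 : R) <= t by rewrite lexx ltW.
have inI (s : R) : s \in `]0, t[%R -> 0 <= s <= t.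
  by rewrite in_itv /= => /andP[/ltW -> /ltW ->].
have swap s : z + t *: v + s *: u = z + s *: u + t *: v by rewrite addrAC.
have flat s : z + s *: u + 0 *: v = z + s *: u by rewrite scale0r addr0.
have dG s : 0 <= s <= t -> is_derive s (1 : R)
    (fun s : R => gi (z + t *: v + s *: u) - gi (z + s *: u))
    ('D_u g (z + t *: v + s *: u) ord0 i - 'D_u g (z + s *: u) ord0 i).
  move=> st; apply: is_deriveB.
    apply: (is_derive_coord _ _ _ _ _).1; apply: is_derive_line.
    by rewrite swap; apply: (dg _ _ st tt).1.
  apply: (is_derive_coord _ _ _ _ _).1; apply: is_derive_line.
  by rewrite -flat; apply: (dg _ _ st zt).1.
have [|a] := @MVT_segment R _ _ 0 t (ltW t0) (fun s sI => dG s (inI s sI)).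
  apply: derivable_within_continuous => s; rewrite in_itv /= => st.
  exact: (@ex_derive _ _ _ _ _ _ _ (dG s st)).
rewrite in_itv /= => at_; rewrite !scale0r !addr0 subr0 !swap => Ea.
have dH s : 0 <= s <= t -> is_derive s (1 : R)
    (fun s : R => 'D_u g (z + a *: u + s *: v) ord0 i)
    ('D_v ('D_u g) (z + a *: u + s *: v) ord0 i).
  move=> st; apply: (is_derive_coord _ _ _ _ _).1; apply: is_derive_line.
  exact: (dg _ _ at_ st).2.
have [|b] := @MVT_segment R _ _ 0 t (ltW t0) (fun s sI => dH s (inI s sI)).
  apply: derivable_within_continuous => s; rewrite in_itv /= => st.
  exact: (@ex_derive _ _ _ _ _ _ _ (dH s st)).
rewrite in_itv /= => bt; rewrite flat subr0 => Eb.
exists a, b; split => //.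
rewrite -Eb -Ea.
by move: (gi _) (gi _) (gi _) (gi _) => *; ring.
Qed.

(** If the two mixed derivatives differed at z in some coordinate, they would
    be apart on a whole ball around z, whereas the second difference over a small
    parallelogram in this ball equals both of them up to the same factor. *)
Lemma derive_comm m (g : V -> 'rV[R]_m) (z u v : V) :
  (\forall y \near z, [/\ differentiable g y, differentiable ('D_u g) y &
    differentiable ('D_v g) y]) ->
  {for z, continuous ('D_v ('D_u g))} -> {for z, continuous ('D_u ('D_v g))} ->
  'D_v ('D_u g) z = 'D_u ('D_v g) z.
Proof.
move=> dg cvu cuv; apply/rowP => i.
pose Dvu y := 'D_v ('D_u g) y ord0 i; pose Duv y := 'D_u ('D_v g) y ord0 i.
apply/eqP/negPn/negP => ne.
have [e e0 ee] : exists2 e, 0 < e & `|Dvu z - Duv z| = e + e.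
  exists (`|Dvu z - Duv z| / 2); last exact: splitr.
  by apply: divr_gt0; rewrite // normr_gt0 subr_eq0.
have near_good : \forall y \near z, [/\ differentiable g y,
    differentiable ('D_u g) y, differentiable ('D_v g) y,
    `|Dvu z - Dvu y| < e & `|Duv z - Duv y| < e].
  have c1 : \forall y \near z, `|Dvu z - Dvu y| < e.
    have : {for z, continuous Dvu} := continuous_component _ _ _ i cvu.
    by move=> /cvgrPdist_lt; apply.
  have c2 : \forall y \near z, `|Duv z - Duv y| < e.
    have : {for z, continuous Duv} := continuous_component _ _ _ i cuv.
    by move=> /cvgrPdist_lt; apply.
  by apply: filterS3 dg c1 c2 => y [].
have [r /= r0 good] := (nbhs_ballP _ _).1 near_good.
have [t t0 tr] : exists2 t, 0 < t & t * (`|u| + `|v| + 1) = r.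
  have n0 : 0 < `|u| + `|v| + 1 by rewrite ltr_wpDl// addr_ge0.
  by exists (r / (`|u| + `|v| + 1)); [exact: divr_gt0|rewrite divfK// gt_eqF].
have inball a b : 0 <= a <= t -> 0 <= b <= t -> ball z r (z + a *: u + b *: v).
  move=> /andP[a0 at_] /andP[b0 bt]; rewrite -ball_normE /= -addrA opprD addNKr.
  rewrite normrN (le_lt_trans (ler_normD _ _))// !normrZ !ger0_norm//.
  apply: le_lt_trans (lerD (ler_wpM2r _ at_) (ler_wpM2r _ bt)) _ => //.
  by rewrite -tr -mulrDr ltr_pM2l// ltrDl.
have [|a [b [at_ bt E1]]] := @mixed_difference m g i z u v t t0.
  by move=> a b at_ bt; have [] := good _ (inball _ _ at_ bt).
have [|b' [a' [b't a't E2]]] := @mixed_difference m g i z v u t t0.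
  move=> b' a' b't a't; rewrite addrAC.
  by have [] := good _ (inball _ _ a't b't).
have [_ _ _ h1 _] := good _ (inball _ _ at_ bt).
have [_ _ _ _ h2] := good _ (inball _ _ a't b't).
have E : Dvu (z + a *: u + b *: v) = Duv (z + a' *: u + b' *: v).
  have tn0 : t != 0 by rewrite gt_eqF.
  apply: (mulIf tn0); apply: (mulIf tn0).
  have -> : z + a' *: u + b' *: v = z + b' *: v + a' *: u by rewrite addrAC.
  apply: (eq_trans (esym E1)); apply: (eq_trans _ E2).
  have -> : z + t *: v + t *: u = z + t *: u + t *: v by rewrite addrAC.
  by move: (g _ _ _) (g _ _ _) (g _ _ _) (g _ _ _) => *; ring.
exact: (far_apart _ _ _ _ _ _ h1 h2 ee E).
Qed.
End Schwarz.

(** * Functions of class C1 at a point *)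

Section C1.
Context {R : realType} {V : normedModType R}.

(** Continuity of the derivatives is required at p only: it serves to
    bound, near p, the coefficient of the equation that q satisfies. *)
Definition C1_at (W : normedModType R) (p : V) (g : V -> W) : Prop :=
  (\forall z \near p, differentiable g z) /\
  forall v, {for p, continuous ('D_v g)}.

Lemma C1_continuous (W : normedModType R) p (g : V -> W) :
  C1_at W p g -> {for p, continuous g}.
Proof. by move=> [/nbhs_singleton dg _]; exact: differentiable_continuous. Qed.

Lemma continuous_near_eq (W : normedModType R) (p : V) (g h : V -> W) :
  (\forall z \near p, g z = h z) -> {for p, continuous h} ->
  {for p, continuous g}.
Proof.
move=> gh hc; change (g x @[x --> p] --> g p).
have -> : g p = h p by exact: nbhs_singleton gh.
by apply: cvg_trans hc; apply: near_eq_cvg; apply: filterS gh => z ->.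
Qed.

Lemma C1_sub (p : V) (g h : V -> R) :
  C1_at R p g -> C1_at R p h -> C1_at R p (fun z => g z - h z).
Proof.
move=> [dg gc] [dh hc]; split=> [|v].
  near=> z; have dgz : differentiable g z by near: z.
  have dhz : differentiable h z by near: z.
  exact: differentiableB.
apply: continuous_near_eq (contB _ _ _ (gc v) (hc v)).
near=> z; have dgz : differentiable g z by near: z.
have dhz : differentiable h z by near: z.
by apply: deriveB; exact: diff_derivable.
Unshelve. all: by end_near. Qed.

Lemma C1_add (p : V) (g h : V -> R) :
  C1_at R p g -> C1_at R p h -> C1_at R p (fun z => g z + h z).
Proof.
move=> [dg gc] [dh hc]; split=> [|v].
  near=> z; have dgz : differentiable g z by near: z.
  have dhz : differentiable h z by near: z.
  exact: differentiableD.
apply: continuous_near_eq (contD _ _ _ (gc v) (hc v)).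
near=> z; have dgz : differentiable g z by near: z.
have dhz : differentiable h z by near: z.
by apply: deriveD; exact: diff_derivable.
Unshelve. all: by end_near. Qed.

Lemma C1_mul (p : V) (g h : V -> R) :
  C1_at R p g -> C1_at R p h -> C1_at R p (fun z => g z * h z).
Proof.
move=> Cg Ch; have [dg gc] := Cg; have [dh hc] := Ch; split=> [|v].
  near=> z; have dgz : differentiable g z by near: z.
  have dhz : differentiable h z by near: z.
  exact: differentiableM.
apply: continuous_near_eq (contD _ _ _ (contM _ _ _ (C1_continuous _ _ _ Cg) (hc v))
  (contM _ _ _ (C1_continuous _ _ _ Ch) (gc v))).
near=> z; have dgz : differentiable g z by near: z.
have dhz : differentiable h z by near: z.
by apply: deriveM; exact: diff_derivable.
Unshelve. all: by end_near. Qed.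

Lemma C1_opp (p : V) (g : V -> R) : C1_at R p g -> C1_at R p (fun z => - g z).
Proof.
move=> [dg gc]; split=> [|v].
  near=> z; have dgz : differentiable g z by near: z.
  exact: differentiableN.
apply: (@continuous_near_eq _ _ _ (fun z => - 'D_v g z)); last exact: continuousN.
near=> z; have dgz : differentiable g z by near: z.
by apply: deriveN; exact: diff_derivable.
Unshelve. all: by end_near. Qed.

Lemma C1_sqrt (p : V) (g : V -> R) :
  C1_at R p g -> 0 < g p -> C1_at R p (fun z => Num.sqrt (g z)).
Proof.
move=> Cg gp0; have [dg gc] := Cg; have cg := C1_continuous _ _ _ Cg.
have near0 : \forall z \near p, 0 < g z by exact: (@cvgr_gt _ _ _ _ _ (g p)).
have cs : {for p, continuous (fun z => Num.sqrt (g z))}.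
  by apply: continuous_comp => //; exact: sqrt_continuous.
have ds z : differentiable g z -> 0 < g z ->
    differentiable (fun z => Num.sqrt (g z)) z.
  move=> dgz gz; apply: (@differentiable_comp _ _ _ _ g (@Num.sqrt R)) => //.
  by apply/derivable1_diffP; exact: (@ex_derive _ _ _ _ _ _ _ (is_derive1_sqrt gz)).
split=> [|v].
  near=> z; apply: ds; first by near: z.
  by near: z.
apply: (@continuous_near_eq _ _ _ (fun z => 'D_v g z / (2 * Num.sqrt (g z)))); last first.
  apply: contM => //; apply: continuousV; last first.
    by apply: contM => //; exact: cst_continuous.
  by rewrite mulf_neq0// sqrtr_eq0 -ltNge.
near=> z; have dgz : differentiable g z by near: z.
have gz : 0 < g z by near: z.
have s0 : Num.sqrt (g z) != 0 by rewrite sqrtr_eq0 -ltNge.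
have dsz := derivable_is_derive _ _ _ v (ds z dgz gz).
have d2 : is_derive z v (fun z => Num.sqrt (g z) * Num.sqrt (g z)) _ :=
  is_deriveM dsz dsz.
have eq2 : \forall y \near z, g y = Num.sqrt (g y) * Num.sqrt (g y).
  have cgz : {for z, continuous g} by exact: differentiable_continuous.
  have : \forall y \near z, 0 < g y by exact: (@cvgr_gt _ _ _ _ _ (g z)).
  by apply: filterS => y gy; rewrite -expr2 sqr_sqrtr// ltW.
(* The derivative of the square root follows from that of its square. *)
rewrite (near_eq_derive v eq2) (@derive_val _ _ _ _ _ _ _ d2).
rewrite -[_ *: _]/(_ * _).
by move: ('D_v _ z) s0 => d s0; field.
Unshelve. all: by end_near. Qed.

Lemma C1_inner (c : R) (p : V) (g h : V -> 'rV[R]_(ambient_dim c)) :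
  C1_at _ p g -> C1_at _ p h -> C1_at R p (fun z => inner (g z) (h z)).
Proof.
move=> Cg Ch; have [dg gc] := Cg; have [dh hc] := Ch; split=> [|v].
  near=> z; have dgz : differentiable g z by near: z.
  have dhz : differentiable h z by near: z.
  exact: differentiable_inner.
apply: continuous_near_eq
  (contD _ _ _ (continuous_inner _ _ _ (gc v) (C1_continuous _ _ _ Ch))
  (continuous_inner _ _ _ (C1_continuous _ _ _ Cg) (hc v))).
near=> z; have dgz : differentiable g z by near: z.
have dhz : differentiable h z by near: z.
exact: (@derive_val _ _ _ _ _ _ _ (is_derive_inner _ _ _ _ _ _
  (derivable_is_derive _ _ _ _ dgz) (derivable_is_derive _ _ _ _ dhz))).
Unshelve. all: by end_near. Qed.

Lemma smooth_C1 (W : normedModType R) (U : set V) (g : V -> W) p :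
  open U -> U p -> smooth U g -> C1_at W p g.
Proof.
move=> oU Up sg; have [dg gc] := sg 1%N; split=> [|v]; last exact: gc.
by near=> z; apply: dg; near: z; exact: open_nbhs_nbhs.
Unshelve. all: by end_near. Qed.

Lemma smooth_derive (W : normedModType R) (U : set V) (g : V -> W) v :
  smooth U g -> smooth U ('D_v g).
Proof. by move=> sg k; have [_] := sg k.+1; apply. Qed.

Lemma smooth_differentiable (W : normedModType R) (U : set V) (g : V -> W) z :
  smooth U g -> U z -> differentiable g z.
Proof. by move=> sg; have [dg _] := sg 1%N; exact: dg. Qed.

Lemma smooth_continuous (W : normedModType R) (U : set V) (g : V -> W) z :
  smooth U g -> U z -> {for z, continuous g}.
Proof. by move=> sg; exact: (sg 0%N). Qed.

Lemma smooth_derive_comm m (U : set V) (g : V -> 'rV[R]_m) (z u v : V) :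
  open U -> smooth U g -> U z -> 'D_v ('D_u g) z = 'D_u ('D_v g) z.
Proof.
move=> oU sg Uz; apply: (@derive_comm R V m g z u v).
- have : \forall y \near z, U y by exact: open_nbhs_nbhs.
  apply: filterS => y Uy.
  by split; apply: smooth_differentiable Uy => //; exact: smooth_derive.
- by apply: smooth_continuous Uz; do 2 apply: smooth_derive.
- by apply: smooth_continuous Uz; do 2 apply: smooth_derive.
Qed.
End C1.

(** * The Codazzi equation along null fields *)

Lemma derive_near_cst (R : realType) (V W : normedModType R) (g : V -> W)
    (k : W) (z v : V) dg :
  (\forall y \near z, g y = k) -> is_derive z v g dg -> dg = 0.
Proof.
move=> gk dgz; rewrite -(@derive_val _ _ _ _ _ _ _ dgz).
by rewrite (@near_eq_derive _ _ _ g (cst k))// derive_cst.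
Qed.

Lemma cramer2 (R : realType) (x1 x2 y1 y2 k1 k2 a1 a2 q : R) :
  x1 * y2 - x2 * y1 != 0 -> x1 * a1 + x2 * a2 = q -> y1 * a1 + y2 * a2 = 0 ->
  k1 * a1 + k2 * a2 = q * ((k1 * y2 - k2 * y1) / (x1 * y2 - x2 * y1)).
Proof.
move=> D0 Eq E0.
apply: (mulIf D0); rewrite -mulrA divfK// -Eq.
transitivity ((x1 * a1 + x2 * a2) * (k1 * y2 - k2 * y1)
    - (k1 * x2 - k2 * x1) * (y1 * a1 + y2 * a2)); first by ring.
by rewrite E0 mulr0 subr0.
Qed.

Section Codazzi.
Context {R : realType} {c : R} {V : normedModType R}.
Local Notation E := 'rV[R]_(ambient_dim c).

(** Vector fields on the parameter domain and their images in the ambient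
    space are both of this form, in the bases (e1, e2) and (D_e1 f, D_e2 f). *)
Definition comb (W : lmodType R) (x1 x2 : V -> R) (A1 A2 : V -> W) : V -> W :=
  fun y => x1 y *: A1 y + x2 y *: A2 y.

Lemma is_derive_comb m (x1 x2 : V -> R) (A1 A2 : V -> 'rV[R]_m) (z v : V) :
  differentiable x1 z -> differentiable x2 z ->
  differentiable A1 z -> differentiable A2 z ->
  is_derive z v (comb _ x1 x2 A1 A2)
    (('D_v x1 z *: A1 z + x1 z *: 'D_v A1 z) +
     ('D_v x2 z *: A2 z + x2 z *: 'D_v A2 z)).
Proof.
move=> dx1 dx2 dA1 dA2.
by apply: is_derive_add; apply: is_derive_scale; exact: derivable_is_derive.
Qed.

(** With M_X = D_X mu and M_Y = D_Y mu, where mu = nu + H f, the product rule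
    gives D_Y q = < D_Y M_X, T_X > + < M_X, D_Y T_X >.  The second term is a multiple
    of q because M_X is parallel to T_Y with factor q / lam.  In the first one
    D_Y M_X = D_X M_Y + [Y, X] mu, by symmetry of the second derivatives of mu.
    Here < D_X M_Y, T_X > = 0: differentiate < M_Y, T_X > = 0 along X, and use that
    M_Y is parallel to T_X, which is orthogonal to D_X T_X as < T_X, T_X > = 0.
    Finally [Y, X] mu is a combination of M_X and M_Y, with < M_X, T_X > = q and
    < M_Y, T_X > = 0. *)
Lemma codazzi (e1 e2 : V) (x1 x2 y1 y2 : V -> R) (T1 T2 P1 P2 : V -> E)
    (z : V) (rho lam : R) :
  let X := comb _ x1 x2 (fun=> e1) (fun=> e2) in
  let Y := comb _ y1 y2 (fun=> e1) (fun=> e2) in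
  let TX := comb _ x1 x2 T1 T2 in let TY := comb _ y1 y2 T1 T2 in
  let MX := comb _ x1 x2 P1 P2 in let MY := comb _ y1 y2 P1 P2 in
  let q := fun y => inner (MX y) (TX y) in
  [/\ differentiable x1 z, differentiable x2 z, differentiable y1 z
    & differentiable y2 z] ->
  [/\ differentiable T1 z, differentiable T2 z, differentiable P1 z
    & differentiable P2 z] ->
  'D_e2 P1 z = 'D_e1 P2 z ->
  (\forall y \near z, inner (TX y) (TX y) = 0) ->
  (\forall y \near z, inner (MY y) (TX y) = 0) ->
  MX z = (q z / lam) *: TY z -> MY z = rho *: TX z ->
  x1 z * y2 z - x2 z * y1 z != 0 ->
  'D_(Y z) q z = q z *
    ((('D_(Y z) x1 z - 'D_(X z) y1 z) * y2 z -
      ('D_(Y z) x2 z - 'D_(X z) y2 z) * y1 z) / (x1 z * y2 z - x2 z * y1 z) +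
     inner (TY z) (('D_(Y z) x1 z *: T1 z + x1 z *: 'D_(Y z) T1 z) +
     ('D_(Y z) x2 z *: T2 z + x2 z *: 'D_(Y z) T2 z)) / lam).
Proof.
move=> X Y TX TY MX MY q [dx1 dx2 dy1 dy2] [dT1 dT2 dP1 dP2] P12 nullX conjXY
  MXz MYz D0.
pose D (f1 f2 : V -> R) (A1 A2 : V -> E) v : E :=
  ('D_v f1 z *: A1 z + f1 z *: 'D_v A1 z) +
  ('D_v f2 z *: A2 z + f2 z *: 'D_v A2 z).
have dTX v : is_derive z v TX (D x1 x2 T1 T2 v) by exact: is_derive_comb.
have dMX v : is_derive z v MX (D x1 x2 P1 P2 v) by exact: is_derive_comb.
have dMY v : is_derive z v MY (D y1 y2 P1 P2 v) by exact: is_derive_comb.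
rewrite -/(D x1 x2 T1 T2 (Y z)).
have null' : inner (TX z) (D x1 x2 T1 T2 (X z)) = 0.
  have := derive_near_cst _ _ _ _ _ _ _ _ nullX
    (is_derive_inner _ _ _ _ _ _ (dTX (X z)) (dTX (X z))).
  by rewrite innerC -mulr2n => /eqP; rewrite mulrn_eq0 /= => /eqP.
have conj' : inner (D y1 y2 P1 P2 (X z)) (TX z) = 0.
  have := derive_near_cst _ _ _ _ _ _ _ _ conjXY
    (is_derive_inner _ _ _ _ _ _ (dMY (X z)) (dTX (X z))).
  by rewrite MYz innerZl null' mulr0 addr0.
have conj0 := nbhs_singleton conjXY.
rewrite (@derive_val _ _ _ _ _ _ _ (is_derive_inner _ _ _ _ _ _ (dMX (Y z)) (dTX (Y z)))).
rewrite MXz innerZl mulrDr; congr (_ + _); last first.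
  by rewrite mulrAC -mulrA.
rewrite -(cramer2 _ _ _ _ _ _ _ (inner (P1 z) (TX z)) (inner (P2 z) (TX z)) _ D0).
- have -> : D x1 x2 P1 P2 (Y z) =
      (('D_(Y z) x1 z - 'D_(X z) y1 z) *: P1 z +
       ('D_(Y z) x2 z - 'D_(X z) y2 z) *: P2 z) + D y1 y2 P1 P2 (X z).
    rewrite /D.
    move: ('D_(Y z) x1 z) ('D_(Y z) x2 z) ('D_(X z) y1 z) ('D_(X z) y2 z).
    move=> x1' x2' y1' y2'.
    rewrite /X /Y /comb !derive_lin// P12.
    move: ('D_e1 P1 z) ('D_e1 P2 z) ('D_e2 P2 z) (P1 z) (P2 z) => ? ? ? ? ?.
    by apply/rowP => i; rewrite !mxE; ring.
  by rewrite [LHS]innerDl conj' addr0 innerDl !innerZl.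
- by rewrite /q /MX /comb [in RHS]innerDl !innerZl.
- by rewrite -conj0 /MY /comb [in RHS]innerDl !innerZl.
Qed.
End Codazzi.

(** * Linear algebra of the ambient space and of the tangent plane *)

Section Ambient.
Context {R : realType} {c : R}.
Local Notation E := 'rV[R]_(ambient_dim c).

(** With D the diagonal matrix of the signs, the Gram matrix B D B^T of such a
    family is invertible, hence so are the matrix B of its vectors and D, and
    w D B^T = 0 forces w = 0. *)
Lemma orthogonal_basis_nondegenerate (b : 'I_(ambient_dim c) -> E) (w : E) :
  (forall i j, i != j -> inner (b i) (b j) = 0) ->
  (forall i, inner (b i) (b i) != 0) ->
  (forall i, inner w (b i) = 0) -> w = 0.
Proof.
move=> ortho self wb.
pose B := \matrix_(i, j) b i ord0 j.
pose D := diag_mx (\row_i @ambient_sign R c i).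
have rowB i : row i B = b i by apply/rowP => j; rewrite !mxE.
have entry m (A : 'M[R]_(m, ambient_dim c)) i j :
    (A *m D *m B^T) i j = inner (row i A) (b j).
  rewrite !mxE; apply: eq_bigr => k _; rewrite !mul_mx_diag !mxE.
  by rewrite [A _ _ * _]mulrC.
have gram : B *m D *m B^T = diag_mx (\row_i inner (b i) (b i)).
  apply/matrixP => i j; rewrite entry rowB !mxE.
  by case: eqVneq => [->|/ortho ->]; rewrite ?mulr1n ?mulr0n.
have : B *m D *m B^T \in unitmx.
  by rewrite gram unitmxE det_diag unitfE; apply/prodf_neq0 => i _; rewrite mxE.
rewrite !unitmx_mul => /andP[/andP[_ uD] uB].
have : w *m D *m B^T = 0.
  by apply/matrixP => i j; rewrite entry mxE ord1 row_id wb.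
move=> /(congr1 (mulmx^~ (invmx (B^T)))); rewrite mulmxK// mul0mx.
by move=> /(congr1 (mulmx^~ (invmx D))); rewrite mulmxK// mul0mx.
Qed.

(** x + y, x - y, nu, and also f when c != 0, form an orthogonal basis of the
    ambient space without null vectors: its dimension is 3 if c = 0 and 4 otherwise. *)
Lemma tangent_frame_nondegenerate (x y nu f w : E) (lam : R) :
  inner x x = 0 -> inner y y = 0 -> inner x y = lam -> lam != 0 ->
  inner nu nu = 1 -> inner x nu = 0 -> inner y nu = 0 ->
  (c != 0 -> [/\ inner f f = c^-1, inner f nu = 0, inner x f = 0
    & inner y f = 0]) ->
  inner w x = 0 -> inner w y = 0 -> inner w nu = 0 ->
  (c != 0 -> inner w f = 0) -> w = 0.
Proof.
move=> xx yy xy lam0 nunu xnu ynu fc wx wy wnu wf.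
pose s := [:: x + y; x + -1 *: y; nu; f].
have cN3 (i : 'I_(ambient_dim c)) : (i < 4)%N /\ (i = 3 :> nat -> c != 0).
  case: i => i /=; rewrite /ambient_dim; case: eqVneq => // _ i3.
  by split; [exact: leq_trans i3 _|move=> i3'; rewrite i3' in i3].
have yx := innerC y x; have nux := innerC nu x; have nuy := innerC nu y.
have fx := innerC f x; have fy := innerC f y; have nuf := innerC nu f.
apply: (orthogonal_basis_nondegenerate (fun i => nth 0 s i)).
- move=> i j; rewrite -val_eqE /=; have [i4 ci] := cN3 i; have [j4 cj] := cN3 j.
  move: i4 ci j4 cj; case: (val i) => [|[|[|[|?]]]] // _ ci;
  case: (val j) => [|[|[|[|?]]]] // _ cj //= _;
  try (have [ff fnu xf yf] := fc (ci erefl));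
  try (have [ff fnu xf yf] := fc (cj erefl));
  rewrite ?innerE ?yx ?nux ?nuy ?fx ?fy ?nuf ?xx ?yy ?xy ?xnu ?ynu ?ff ?fnu ?xf ?yf; ring.
- move=> i; have [i4 ci] := cN3 i; move: i4 ci.
  case: (val i) => [|[|[|[|?]]]] // _ ci /=.
  + rewrite !innerE yx xx yy xy; apply: contra_neq lam0; lra.
  + rewrite !innerE yx xx yy xy; apply: contra_neq lam0; lra.
  + by rewrite nunu oner_neq0.
  + by have [-> _ _ _] := fc (ci erefl); rewrite invr_neq0// ci.
- move=> i; have [i4 ci] := cN3 i; move: i4 ci.
  case: (val i) => [|[|[|[|?]]]] // _ ci /=; rewrite ?innerE ?wx ?wy ?wnu; try ring.
  by rewrite wf// ci.
Qed.
End Ambient.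

Section Plane.

Lemma sum_ord2 (W : nmodType) (F : 'I_2 -> W) : \sum_i F i = F 0 + F 1.
Proof.
by rewrite !big_ord_recl big_ord0 addr0; congr (_ + F _); apply/val_inj.
Qed.

Lemma det_mx2 (F : comNzRingType) (A : 'M[F]_2) :
  \det A = A 0 0 * A 1 1 - A 0 1 * A 1 0.
Proof.
have l0 : lift (0 : 'I_2) (0 : 'I_1) = 1 by apply/val_inj.
have l1 : lift (1 : 'I_2) (0 : 'I_1) = 0 by apply/val_inj.
rewrite (expand_det_row _ 0) sum_ord2 /cofactor !det_mx11 !mxE l0 l1 /=.
by rewrite expr0 expr1 mul1r mulN1r mulrN.
Qed.

Lemma eigenvalue_char2 (F : fieldType) (A : 'M[F]_2) (k : F) :
  eigenvalue A k -> k ^+ 2 - \tr A * k + \det A = 0.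
Proof.
move=> /eigenvalueP[v vA v0].
have : \det (A - k%:M) = 0.
  apply/eqP/det0P; exists v => //.
  by rewrite mulmxBr vA mul_mx_scalar subrr.
rewrite !det_mx2 /mxtrace sum_ord2 !mxE /= !mulr1n !mulr0n => <-.
by ring.
Qed.

(** In the basis given by the rows of N, the shape operator is h' times the
    inverse of the antidiagonal matrix of the first fundamental form. *)
Lemma shape_null_frame (F : fieldType) (h I N : 'M[F]_2) (lam : F) :
  lam != 0 ->
  N *m I *m N^T = \matrix_(i, j) (if i == j then 0 else lam) ->
  let h' := N *m h *m N^T in let S := h *m invmx I in
  [/\ I \in unitmx, \tr S = (h' 0 1 + h' 1 0) / lam &
      \det S = (h' 0 1 * h' 1 0 - h' 0 0 * h' 1 1) / lam ^+ 2].
Proof.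
move=> lam0 NI h' S.
have : N *m I *m N^T \in unitmx.
  rewrite unitmxE NI det_mx2 !mxE /= mul0r sub0r unitfE oppr_eq0.
  by rewrite mulf_neq0.
rewrite !unitmx_mul => /andP[/andP[uN uI] _].
have SI : S *m I = h by rewrite mulmxKV.
clearbody S; pose S' := N *m S *m invmx N.
have S'h : S' *m (N *m I *m N^T) = h'.
  by rewrite /S' /h' -SI !mulmxA mulmxKV.
have tS : \tr S = \tr S' by rewrite /S' mxtrace_mulC mulmxA mulVmx// mul1mx.
have dS : \det S = \det S'.
  by rewrite /S' !det_mulmx det_inv mulrAC mulfV ?mul1r// -unitfE -unitmxE.
rewrite NI in S'h.
have col0 i : h' i 0 = S' i 1 * lam.
  by rewrite -S'h mxE sum_ord2 !mxE /= mulr0 add0r.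
have col1 i : h' i 1 = S' i 0 * lam.
  by rewrite -S'h mxE sum_ord2 !mxE /= mulr0 addr0.
split => //.
- by rewrite tS /mxtrace sum_ord2 !col0 !col1 -mulrDl mulfK.
- by rewrite dS det_mx2 !col0 !col1; field.
Qed.
End Plane.

(** * Null frames of a time-like surface *)

Lemma ord2P (i : 'I_2) : i = 0 \/ i = 1.
Proof. by case: i => [[|[|?]]] // ?; [left|right]; exact/val_inj. Qed.

Section Geometry.
Context {R : realType} {c : R}.
Local Notation E := 'rV[R]_(ambient_dim c).
Local Notation V := 'rV[R]_2.
Implicit Types (U : set V) (f nu a b : V -> E) (z v w : V).

Lemma derive_pd a z v : differentiable a z ->
  'D_v a z = v ord0 0 *: pd a 0 z + v ord0 1 *: pd a 1 z.
Proof.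
move=> da.
have vE : v = v ord0 0 *: delta_mx ord0 0 + v ord0 1 *: delta_mx ord0 1.
  by rewrite {1}(row_sum_delta v) sum_ord2.
apply: eq_trans (derive_lin _ a z _ _ _ _ da).
by congr (derive a z _); exact: vE.
Qed.

Lemma gram_comb (A B : 'I_2 -> E) (r : 'I_2 -> V) :
  let N := \matrix_(i, j) r i ord0 j in
  N *m (\matrix_(i, j) inner (A i) (B j)) *m N^T =
    \matrix_(i, j) inner (r i ord0 0 *: A 0 + r i ord0 1 *: A 1)
                         (r j ord0 0 *: B 0 + r j ord0 1 *: B 1).
Proof.
move=> N; apply/matrixP => i j; rewrite !(mxE, sum_ord2).
by rewrite !innerDl !innerDr !innerZl !innerZr; ring.
Qed.

Lemma gram_frame a b (r : 'I_2 -> V) z :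
  differentiable a z -> differentiable b z ->
  let N := \matrix_(i, j) r i ord0 j in
  N *m (\matrix_(i, j) inner (pd a i z) (pd b j z)) *m N^T =
    \matrix_(i, j) inner ('D_(r i) a z) ('D_(r j) b z).
Proof.
move=> da db N.
rewrite (gram_comb (fun i => pd a i z) (fun i => pd b i z)).
apply/matrixP => i j; rewrite [LHS]mxE [RHS]mxE.
by congr inner; apply/esym/derive_pd.
Qed.

(** The sum and the difference of the two vectors of a Lorentzian basis. *)
Lemma null_basis f z : differentiable f z -> lorentzian (first_form f z) ->
  exists e1 e2, [/\ inner ('D_e1 f z) ('D_e1 f z) = 0,
    inner ('D_e2 f z) ('D_e2 f z) = 0 & 0 < inner ('D_e1 f z) ('D_e2 f z)].
Proof.
move=> df [P _ PI].
have G := gram_frame f f (fun i => row i P) z df df.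
have rowsP : \matrix_(i, j) row i P ord0 j = P.
  by apply/matrixP => i j; rewrite !mxE.
rewrite rowsP in G.
have I' i j : inner ('D_(row i P) f z) ('D_(row j P) f z) =
    if i != j then 0 else if i == ord0 then 1 else - 1.
  have := congr1 (fun A : 'M[R]_2 => A i j) (etrans (esym G) PI).
  by rewrite /= [LHS]mxE [RHS]mxE.
have I00 := I' 0 0; have I01 := I' 0 1; have I10 := I' 1 0; have I11 := I' 1 1.
rewrite /= in I00 I01 I10 I11.
exists (1 *: row 0 P + 1 *: row 1 P), (1 *: row 0 P + (-1) *: row 1 P).
rewrite !(derive_lin _ f z _ _ _ _ df).
move: ('D_(row 0 P) f z) ('D_(row 1 P) f z) I00 I01 I10 I11 => a b I00 I01 I10 I11.
by rewrite !innerDl !innerDr !innerZl !innerZr I00 I01 I10 I11; split; lra.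
Qed.

(** A and B are the partial derivatives of f and nu at a point, v and w a pair
    of null vectors; what follows is linear algebra in the tangent plane. *)
Section NullFrame.
Context (A B : 'I_2 -> E) (v w : V) (fv fw nv nw : E) (H lam : R).
Let I : 'M[R]_2 := \matrix_(i, j) inner (A i) (A j).
Let h : 'M[R]_2 := \matrix_(i, j) - inner (B i) (A j).
Let S : 'M[R]_2 := h *m invmx I.
Hypotheses (fvE : fv = v ord0 0 *: A 0 + v ord0 1 *: A 1)
  (fwE : fw = w ord0 0 *: A 0 + w ord0 1 *: A 1)
  (nvE : nv = v ord0 0 *: B 0 + v ord0 1 *: B 1)
  (nwE : nw = w ord0 0 *: B 0 + w ord0 1 *: B 1)
  (sym : inner nw fv = inner nv fw) (trS : \tr S / 2 = H) (lam0 : lam != 0)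
  (vv : inner fv fv = 0) (ww : inner fw fw = 0) (vw : inner fv fw = lam).
Let q := inner (nv + H *: fv) fv.
Let r := inner (nw + H *: fw) fw.
Let N : 'M[R]_2 := \matrix_(i, j) (if i == 0 then v else w) ord0 j.

Lemma frame_first_form :
  N *m I *m N^T = \matrix_(i, j) (if i == j then 0 else lam).
Proof.
have wv : inner fw fv = lam by rewrite innerC.
rewrite /I gram_comb; apply/matrixP => i j; rewrite [LHS]mxE [RHS]mxE.
case: (ord2P i) => ->; case: (ord2P j) => -> /=; rewrite -?fvE -?fwE //.
Qed.

Lemma frame_second_form i j : (N *m h *m N^T) i j =
  - inner (if i == 0 then nv else nw) (if j == 0 then fv else fw).
Proof.
have -> : h = - \matrix_(i, j) inner (B i) (A j).
  by apply/matrixP => k l; rewrite !mxE.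
rewrite mulmxN mulNmx gram_comb [LHS]mxE [X in - X = _]mxE; congr (- inner _ _).
  by case: (ord2P i) => -> /=.
by case: (ord2P j) => -> /=.
Qed.

(** The first fundamental form is lam times the hyperbolic form in a null
    frame, so that the trace only involves the mixed terms of h. *)
Lemma frame_trace : - inner nv fw = H * lam.
Proof.
have [_ tS _] := shape_null_frame _ h _ _ _ lam0 frame_first_form.
move: tS; rewrite !frame_second_form /= sym -/S => tS.
by rewrite -trS tS; field.
Qed.

Lemma frame_conjugate : inner (nv + H *: fv) fw = 0 /\ inner (nw + H *: fw) fv = 0.
Proof.
have wv : inner fw fv = lam by rewrite innerC.
by rewrite !innerDl !innerZl vw wv sym -frame_trace; split; ring.
Qed.

Lemma frame_det : \det S = H ^+ 2 - q * r / lam ^+ 2.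
Proof.
have [_ _] := shape_null_frame _ h _ _ _ lam0 frame_first_form.
rewrite -/S => ->; rewrite !frame_second_form /= sym frame_trace.
rewrite /q /r !innerDl !innerZl vv ww; field.
exact: lam0.
Qed.

Lemma frame_umbilic (t : R) : S = t%:M -> q = 0.
Proof.
have [uI _ _] := shape_null_frame _ h _ _ _ lam0 frame_first_form.
rewrite /S => Sa.
have hE : h = t *: I by rewrite -[LHS](mulmxKV uI) Sa mul_scalar_mx.
have := frame_second_form 0 0.
rewrite hE -scalemxAr -scalemxAl frame_first_form !mxE /= mulr0 => nu0.
by rewrite /q innerDl innerZl vv mulr0 addr0 -[LHS]opprK -nu0 oppr0.
Qed.

(** Weingarten formula: nv + H fv is tangent, and it is orthogonal to fw, so it
    is a multiple of fw in a null frame; pairing with fv gives the factor. *)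
Lemma frame_derive (n0 f0 : E) :
  inner n0 n0 = 1 -> inner fv n0 = 0 -> inner fw n0 = 0 -> inner nv n0 = 0 ->
  (c != 0 -> [/\ inner f0 f0 = c^-1, inner f0 n0 = 0, inner fv f0 = 0
     & inner fw f0 = 0]) ->
  (c != 0 -> inner nv f0 = 0) ->
  nv + H *: fv = (q / lam) *: fw.
Proof.
move=> nn fvn fwn nvn fc nvf; have [Mw _] := frame_conjugate.
have Mvn : inner (nv + H *: fv) n0 = 0.
  by rewrite innerDl innerZl nvn fvn mulr0 addr0.
have Mvf : c != 0 -> inner (nv + H *: fv) f0 = 0.
  move=> c0; have [_ _ fvf _] := fc c0.
  by rewrite innerDl innerZl nvf// fvf mulr0 addr0.
apply/eqP; rewrite -subr_eq0 -scaleNr; apply/eqP.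
apply: (tangent_frame_nondegenerate fv fw n0 f0 _ lam) => //.
- rewrite innerDl innerZl -/q [inner fw _]innerC vw; field. exact: lam0.
- by rewrite innerDl innerZl Mw ww mulr0 addr0.
- by rewrite innerDl innerZl Mvn fwn mulr0 addr0.
- move=> c0; have [_ _ _ fwf] := fc c0.
  by rewrite innerDl innerZl Mvf// fwf mulr0 addr0.
Qed.

(** For q = 0 the characteristic polynomial of S is the square of 'X - H. *)
Lemma frame_eigenvalue k : q = 0 ->
  eigenvalue (map_mx (real_complex R) S) k -> k = real_complex R H.
Proof.
move=> q0 /eigenvalue_char2.
rewrite det_map_mx trace_map_mx frame_det q0 mul0r mul0r subr0.
have -> : \tr S = H * 2 by rewrite -trS divfK.
rewrite rmorphXn rmorphM rmorph_nat /= => kH.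
by apply/eqP; rewrite -subr_eq0 -sqrf_eq0; apply/eqP; rewrite -kH; ring.
Qed.

End NullFrame.

Section Immersion.
Context (U : set V) (f nu : V -> E).
Hypotheses (oU : open U) (fT : timelike_immersion U f) (nuN : unit_normal U f nu).

Lemma immersion_diff z : U z -> differentiable f z.
Proof. by case: fT => sf _ _ _; exact: smooth_differentiable. Qed.

Lemma normal_diff z : U z -> differentiable nu z.
Proof. by case: nuN => sn _; exact: smooth_differentiable. Qed.

Lemma near_domain z : U z -> \forall y \near z, U y.
Proof. by move=> Uz; exact: open_nbhs_nbhs. Qed.

Lemma inner_const_derive (a b : V -> E) k z v :
  (forall y, U y -> inner (a y) (b y) = k) -> U z ->
  differentiable a z -> differentiable b z ->
  inner ('D_v a z) (b z) + inner (a z) ('D_v b z) = 0.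
Proof.
move=> abk Uz da db.
apply: (derive_near_cst _ _ _ (fun y => inner (a y) (b y)) k z v).
  by apply: filterS (near_domain _ Uz) => y; exact: abk.
by apply: is_derive_inner; exact: derivable_is_derive.
Qed.

Lemma normal_tangent z v : U z -> inner ('D_v f z) (nu z) = 0.
Proof.
move=> Uz; case: nuN => _ /(_ z Uz) [_ h _].
by rewrite deriveE//; exact: immersion_diff.
Qed.

Lemma normal_derive_normal z v : U z -> inner ('D_v nu z) (nu z) = 0.
Proof.
move=> Uz; have dn := normal_diff _ Uz.
have h y : U y -> inner (nu y) (nu y) = 1.
  by move=> Uy; case: nuN => _ /(_ y Uy) [].
have := inner_const_derive _ _ _ _ v h Uz dn dn.
by rewrite [inner (nu z) _]innerC -mulr2n => /eqP; rewrite mulrn_eq0 /= => /eqP.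
Qed.

Lemma position z v : U z -> c != 0 ->
  [/\ inner (f z) (f z) = c^-1, inner (f z) (nu z) = 0,
    inner ('D_v f z) (f z) = 0 & inner ('D_v nu z) (f z) = 0].
Proof.
move=> Uz c0; have dn := normal_diff _ Uz; have df := immersion_diff _ Uz.
have hf y : U y -> inner (f y) (f y) = c^-1.
  by move=> Uy; case: fT => _ fM _ _; apply: (fM (f y)) c0; exists y.
have hn y : U y -> inner (f y) (nu y) = 0.
  by move=> Uy; case: nuN => _ /(_ y Uy) [_ _]; apply.
split; [exact: hf|exact: hn| |].
- have := inner_const_derive _ _ _ _ v hf Uz df df.
  by rewrite [inner (f z) _]innerC -mulr2n => /eqP; rewrite mulrn_eq0 /= => /eqP.
- have := inner_const_derive _ _ _ _ v hn Uz df dn.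
  by rewrite normal_tangent// add0r innerC.
Qed.

(** Both sides are opposite to the scalar product of nu with a second
    derivative of f, and second derivatives commute. *)
Lemma second_form_sym z v w : U z ->
  inner ('D_v nu z) ('D_w f z) = inner ('D_w nu z) ('D_v f z).
Proof.
move=> Uz; have dn := normal_diff _ Uz.
have sf : smooth U f by case: fT.
have h u y : U y -> inner (nu y) ('D_u f y) = 0.
  by move=> Uy; rewrite innerC normal_tangent.
have dDf u : differentiable ('D_u f) z.
  by apply: smooth_differentiable Uz; exact: smooth_derive.
have h1 := inner_const_derive _ _ _ _ v (h w) Uz dn (dDf w).
have h2 := inner_const_derive _ _ _ _ w (h v) Uz dn (dDf v).
have comm := smooth_derive_comm _ U f z w v oU sf Uz.
rewrite comm in h1.
exact: (addIr _ (etrans h1 (esym h2))).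
Qed.

(** The pointwise content of the null frame (v, w); the images of v and w under
    df and under d (nu + H f) are variables so that they can be given in any form. *)
Lemma null_frame z v w (H lam : R) (fv fw mv mw : E) :
  'D_v f z = fv -> 'D_w f z = fw ->
  'D_v nu z + H *: 'D_v f z = mv -> 'D_w nu z + H *: 'D_w f z = mw ->
  U z -> mean_curvature f nu z = H -> lam != 0 ->
  inner fv fv = 0 -> inner fw fw = 0 -> inner fv fw = lam ->
  [/\ inner mw fv = 0,
      mv = (inner mv fv / lam) *: fw,
      mw = (inner mw fw / lam) *: fv,
      umbilic f nu z -> inner mv fv = 0 &
      ~ umbilic f nu z -> inner mv fv = 0 -> quasi_umbilic f nu z].
Proof.
move=> <- <- <- <- Uz Hz lam0 vv ww vw.
have df := immersion_diff _ Uz; have dn := normal_diff _ Uz.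
have sym := second_form_sym z w v Uz.
have Fv := derive_pd f z v df; have Fw := derive_pd f z w df.
have Nv := derive_pd nu z v dn; have Nw := derive_pd nu z w dn.
have nun : inner (nu z) (nu z) = 1 by case: nuN => _ /(_ z Uz) [].
have wv : inner ('D_w f z) ('D_v f z) = lam by rewrite innerC; exact: vw.
have fvn := normal_tangent z v Uz; have fwn := normal_tangent z w Uz.
have nvn := normal_derive_normal z v Uz; have nwn := normal_derive_normal z w Uz.
have Pv c0 := position z v Uz c0; have Pw c0 := position z w Uz c0.
split.
- by have [] := frame_conjugate _ _ _ _ _ _ _ _ _ _ Fv Fw Nv Nw sym Hz lam0 vv ww vw.
- apply: (frame_derive _ _ _ _ _ _ _ _ _ _ Fv Fw Nv Nw sym Hz lam0 vv ww vw
    (nu z) (f z) nun fvn fwn nvn).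
    move=> c0; have [ff fn fvf _] := Pv c0; have [_ _ fwf _] := Pw c0.
    exact: And4 ff fn fvf fwf.
  by move=> c0; have [_ _ _ nf] := Pv c0.
- apply: (frame_derive _ _ _ _ _ _ _ _ _ _ Fw Fv Nw Nv (esym sym) Hz lam0 ww vv wv
    (nu z) (f z) nun fwn fvn nwn).
    move=> c0; have [ff fn fvf _] := Pv c0; have [_ _ fwf _] := Pw c0.
    exact: And4 ff fn fwf fvf.
  by move=> c0; have [_ _ _ nf] := Pw c0.
- move=> [a Sa].
  exact: (frame_umbilic _ _ _ _ _ _ _ _ H lam Fv Fw Nv Nw lam0 vv ww vw a Sa).
- move=> num q0; split; [exact: num|move=> k1 k2 h1 h2].
  have eig := frame_eigenvalue _ _ _ _ _ _ _ _ _ _ Fv Fw Nv Nw sym Hz lam0 vv ww vw _ q0.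
  exact: etrans (eig _ h1) (esym (eig _ h2)).
Qed.

End Immersion.
End Geometry.

(** * Null fields and the accumulation of quasi-umbilics *)

Section Continuity.
Context {R : realType} {V : normedModType R}.

Lemma derive_addZ (W : normedModType R) (a b : V -> W) (k : R) z v :
  differentiable a z -> differentiable b z ->
  'D_v (fun y => a y + k *: b y) z = 'D_v a z + k *: 'D_v b z.
Proof.
move=> da db; apply: (@derive_val _ _ _ _ _ _ _ (is_deriveD _ _)).
  exact: derivable_is_derive.
by apply: is_deriveZ; exact: derivable_is_derive.
Qed.

Lemma differentiable_addZ (W : normedModType R) (a b : V -> W) (k : R) z :
  differentiable a z -> differentiable b z ->
  differentiable (fun y => a y + k *: b y) z.
Proof.
by move=> da db; apply: differentiableD => //; exact: differentiableZ.
Qed.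

Lemma continuous_comb (W : normedModType R) (x1 x2 : V -> R) (A1 A2 : V -> W) p :
  {for p, continuous x1} -> {for p, continuous x2} ->
  {for p, continuous A1} -> {for p, continuous A2} ->
  {for p, continuous (comb W x1 x2 A1 A2)}.
Proof.
by move=> c1 c2 cA1 cA2; apply: continuousD; exact: continuousZ.
Qed.

Lemma continuous_derive_along (W : normedModType R) (g : V -> W)
    (a1 a2 : V -> R) (e1 e2 p : V) :
  C1_at W p g -> {for p, continuous a1} -> {for p, continuous a2} ->
  {for p, continuous (fun z => 'D_(comb V a1 a2 (fun=> e1) (fun=> e2) z) g z)}.
Proof.
move=> [dg gc] c1 c2.
apply: (@continuous_near_eq _ _ _ _ _ (comb W a1 a2 ('D_e1 g) ('D_e2 g))).
  by apply: filterS dg => z dgz; exact: derive_lin.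
by apply: continuous_comb; [exact: c1|exact: c2|exact: gc|exact: gc].
Qed.

End Continuity.

(** The null fields are obtained from the roots of the quadratic form, scaled
    so as to avoid divisions by E or G, which vanish at p. *)
Lemma null_combination (R : realType) (E F G s : R) : s * s = F * F - E * G ->
  let u := F + s in
  u * (u * E + - E * F) + - E * (u * F + - E * G) = 0 /\
  - G * (- G * E + u * F) + u * (- G * F + u * G) = 0.
Proof.
move=> ss u; split.
  transitivity (E * (s * s - (F * F - E * G))); first by rewrite /u; ring.
  by rewrite ss subrr mulr0.
transitivity (G * (s * s - (F * F - E * G))); first by rewrite /u; ring.
by rewrite ss subrr mulr0.
Qed.

Section Main.
Context {R : realType} {c : R}.
Local Notation E := 'rV[R]_(ambient_dim c).
Local Notation V := 'rV[R]_2.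
Context (U : set V) (f nu : V -> E) (H : R) (e1 e2 p : V).
(* T and N name the derivatives of f and nu along e1 and e2; the computations
   treat them as arbitrary vector fields. *)
Context (T1 T2 N1 N2 : V -> E).
Hypotheses (T1E : 'D_e1 f = T1) (T2E : 'D_e2 f = T2)
  (N1E : 'D_e1 nu = N1) (N2E : 'D_e2 nu = N2).
Hypotheses (oU : open U) (fT : timelike_immersion U f) (nuN : unit_normal U f nu)
  (Hcst : forall x, U x -> mean_curvature f nu x = H) (Up : U p).

Let P1 z := N1 z + H *: T1 z.
Let P2 z := N2 z + H *: T2 z.
Let Ef z := inner (T1 z) (T1 z).
Let Ff z := inner (T1 z) (T2 z).
Let Gf z := inner (T2 z) (T2 z).
Let disc z := Ff z * Ff z - Ef z * Gf z.
Let u z := Ff z + Num.sqrt (disc z).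
Let mE z := - Ef z.
Let mG z := - Gf z.
Let X := comb _ u mE (fun=> e1) (fun=> e2).
Let Y := comb _ mG u (fun=> e1) (fun=> e2).
Let TX := comb _ u mE T1 T2.
Let TY := comb _ mG u T1 T2.
Let MX := comb _ u mE P1 P2.
Let MY := comb _ mG u P1 P2.
Let q y := inner (MX y) (TX y).
Let lam y := inner (TX y) (TY y).
Let jac z := u z * u z - mE z * mG z.

Hypotheses (E0 : Ef p = 0) (G0 : Gf p = 0) (F0 : 0 < Ff p).

Let sf : smooth U f. Proof. by case: fT. Qed.
Let sn : smooth U nu. Proof. by case: nuN. Qed.
Let sT1 : smooth U T1. Proof. by rewrite -T1E; exact: smooth_derive. Qed.
Let sT2 : smooth U T2. Proof. by rewrite -T2E; exact: smooth_derive. Qed.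
Let sN1 : smooth U N1. Proof. by rewrite -N1E; exact: smooth_derive. Qed.
Let sN2 : smooth U N2. Proof. by rewrite -N2E; exact: smooth_derive. Qed.

Let df z : U z -> differentiable f z.
Proof. exact: smooth_differentiable. Qed.
Let dn z : U z -> differentiable nu z.
Proof. exact: smooth_differentiable. Qed.

Let TXE z : U z -> 'D_(X z) f z = TX z.
Proof. by move=> Uz; rewrite /TX -T1E -T2E; exact: derive_lin (df _ Uz). Qed.

Let TYE z : U z -> 'D_(Y z) f z = TY z.
Proof. by move=> Uz; rewrite /TY -T1E -T2E; exact: derive_lin (df _ Uz). Qed.

Let combD (x1 x2 : V -> R) z :
  comb _ x1 x2 N1 N2 z + H *: comb _ x1 x2 T1 T2 z = comb _ x1 x2 P1 P2 z.
Proof. by rewrite /comb /P1 /P2; apply/rowP => i; rewrite !mxE; ring. Qed.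

Let MXE z : U z -> 'D_(X z) nu z + H *: 'D_(X z) f z = MX z.
Proof.
move=> Uz; apply: eq_trans (combD _ _ _); congr (_ + H *: _); last exact: TXE.
by rewrite -N1E -N2E; exact: derive_lin (dn _ Uz).
Qed.

Let MYE z : U z -> 'D_(Y z) nu z + H *: 'D_(Y z) f z = MY z.
Proof.
move=> Uz; apply: eq_trans (combD _ _ _); congr (_ + H *: _); last exact: TYE.
by rewrite -N1E -N2E; exact: derive_lin (dn _ Uz).
Qed.

Let null_fields z : 0 < disc z -> inner (TX z) (TX z) = 0 /\ inner (TY z) (TY z) = 0.
Proof.
move=> d0; have ss : Num.sqrt (disc z) * Num.sqrt (disc z) = disc z.
  by rewrite -expr2 sqr_sqrtr// ltW.
have [h1 h2] := null_combination _ _ _ _ _ ss.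
have FC : inner (T2 z) (T1 z) = Ff z by rewrite innerC.
rewrite /TX /TY /comb !innerDl !innerDr !innerZl !innerZr FC.
by split; [rewrite -[RHS]h1|rewrite -[RHS]h2]; rewrite /mE /mG /u /Ef /Gf /Ff; ring.
Qed.

(* The points where (X, Y) is a basis of null vectors. *)
Let good z := [/\ U z, 0 < disc z, jac z != 0 & lam z != 0].

Let good_frame z : good z ->
  [/\ inner (TX z) (TX z) = 0, inner (MY z) (TX z) = 0,
      MX z = (q z / lam z) *: TY z /\
      MY z = (inner (MY z) (TY z) / lam z) *: TX z,
      umbilic f nu z -> q z = 0 &
      ~ umbilic f nu z -> q z = 0 -> quasi_umbilic f nu z].
Proof.
move=> [Uz d0 _ l0]; have [TXX TYY] := null_fields _ d0.
have [h1 h2 h3 h4 h5] := null_frame _ _ _ oU fT nuN z (X z) (Y z) H (lam z)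
  _ _ _ _ (TXE z Uz) (TYE z Uz) (MXE z Uz) (MYE z Uz) Uz (Hcst _ Uz) l0 TXX TYY erefl.
exact: And5 TXX h1 (conj h2 h3) h4 h5.
Qed.

Let CT1 : C1_at E p T1. Proof. exact: (smooth_C1 _ _ _ _ oU Up sT1). Qed.
Let CT2 : C1_at E p T2. Proof. exact: (smooth_C1 _ _ _ _ oU Up sT2). Qed.
Let C1E : C1_at R p Ef. Proof. exact: (C1_inner _ _ _ _ CT1 CT1). Qed.
Let C1G : C1_at R p Gf. Proof. exact: (C1_inner _ _ _ _ CT2 CT2). Qed.
Let C1F : C1_at R p Ff. Proof. exact: (C1_inner _ _ _ _ CT1 CT2). Qed.

Let disc_p : disc p = Ff p * Ff p.
Proof. by rewrite /disc E0 mul0r subr0. Qed.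

Let C1disc : C1_at R p disc.
Proof. exact: (C1_sub _ _ _ (C1_mul _ _ _ C1F C1F) (C1_mul _ _ _ C1E C1G)). Qed.
Let C1u : C1_at R p u.
Proof.
apply: (C1_add _ _ _ C1F); apply: (C1_sqrt _ _ C1disc).
by rewrite disc_p mulr_gt0.
Qed.
Let C1mE : C1_at R p mE. Proof. exact: (C1_opp _ _ C1E). Qed.
Let C1mG : C1_at R p mG. Proof. exact: (C1_opp _ _ C1G). Qed.

Let u_p : u p = Ff p + Ff p.
Proof. by rewrite /u disc_p -expr2 sqrtr_sqr gtr0_norm. Qed.

Let Y_p : TY p = u p *: T2 p.
Proof. by rewrite /TY /comb /mG G0 oppr0 scale0r add0r. Qed.

Let cu := C1_continuous _ _ _ C1u.
Let cmE := C1_continuous _ _ _ C1mE.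
Let cmG := C1_continuous _ _ _ C1mG.
Let cT1 := C1_continuous _ _ _ CT1.
Let cT2 := C1_continuous _ _ _ CT2.

Let lam_p : lam p != 0.
Proof.
rewrite /lam Y_p /TX /comb /mE E0 oppr0 scale0r addr0 innerZl innerZr -/(Ff p) u_p.
by rewrite !mulf_neq0// gt_eqF// ?addr_gt0.
Qed.

Let jac_p : jac p != 0.
Proof.
by rewrite /jac /mE E0 oppr0 mul0r subr0 u_p mulf_neq0// gt_eqF// addr_gt0.
Qed.

Let cTX : {for p, continuous TX}.
Proof. exact: (continuous_comb _ _ _ _ _ _ cu cmE cT1 cT2). Qed.
Let cTY : {for p, continuous TY}.
Proof. exact: (continuous_comb _ _ _ _ _ _ cmG cu cT1 cT2). Qed.
Let clam : {for p, continuous lam}. Proof. exact: (continuous_inner _ _ _ cTX cTY). Qed.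
Let cjac : {for p, continuous jac}.
Proof. exact: (contB _ _ _ (contM _ _ _ cu cu) (contM _ _ _ cmE cmG)). Qed.

Let near_good : \forall z \near p, good z.
Proof.
have n1 : \forall z \near p, U z by exact: (near_domain _ oU p Up).
have n2 : \forall z \near p, 0 < disc z.
  apply: (cvgr_gt _ (C1_continuous _ _ _ C1disc)).
  by rewrite disc_p mulr_gt0.
have n3 : \forall z \near p, jac z != 0.
  exact: (cvgr_neq0 (jac p) cjac jac_p).
have n4 : \forall z \near p, lam z != 0.
  exact: (cvgr_neq0 (lam p) clam lam_p).
by near=> z; split; near: z.
Unshelve. all: by end_near. Qed.

Let P_comm z : U z -> 'D_e2 P1 z = 'D_e1 P2 z.
Proof.
move=> Uz; have d (A : V -> E) : smooth U A -> differentiable A z.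
  by move=> sA; exact: smooth_differentiable Uz.
apply: eq_trans (derive_addZ _ _ _ _ _ _ (d _ sN1) (d _ sT1)) _.
apply: eq_trans (esym (derive_addZ _ _ _ _ _ _ (d _ sN2) (d _ sT2))).
congr (_ + H *: _).
  by rewrite -N1E -N2E; exact: (smooth_derive_comm _ _ _ _ _ _ oU sn Uz).
by rewrite -T1E -T2E; exact: (smooth_derive_comm _ _ _ _ _ _ oU sf Uz).
Qed.

Let coef z :=
  (('D_(Y z) u z - 'D_(X z) mG z) * u z - ('D_(Y z) mE z - 'D_(X z) u z) * mG z)
    / jac z +
  inner (TY z) (('D_(Y z) u z *: T1 z + u z *: 'D_(Y z) T1 z) +
    ('D_(Y z) mE z *: T2 z + mE z *: 'D_(Y z) T2 z)) / lam z.

Let ccoef : {for p, continuous coef}.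
Proof.
have along (W : normedModType R) (g : V -> W) : C1_at W p g ->
    {for p, continuous (fun z => 'D_(Y z) g z)} /\
    {for p, continuous (fun z => 'D_(X z) g z)}.
  move=> Cg; split.
    exact: (continuous_derive_along _ _ _ _ _ _ _ Cg cmG cu).
  exact: (continuous_derive_along _ _ _ _ _ _ _ Cg cu cmE).
have [uY uX] := along _ _ C1u; have [EY _] := along _ _ C1mE.
have [_ GX] := along _ _ C1mG.
have [T1Y _] := along _ _ CT1; have [T2Y _] := along _ _ CT2.
have cj : {for p, continuous (fun z => (jac z)^-1)} by exact: continuousV.
have cl : {for p, continuous (fun z => (lam z)^-1)} by exact: continuousV.
apply: contD; apply: contM => //.
  exact: (contB _ _ _ (contM _ _ _ (contB _ _ _ uY GX) cu)
                      (contM _ _ _ (contB _ _ _ EY uX) cmG)).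
apply: (continuous_inner _ _ _ cTY).
exact: (continuousD (continuousD (continuousZ uY cT1) (continuousZ cu T1Y))
                    (continuousD (continuousZ EY cT2) (continuousZ cmE T2Y))).
Qed.

Let near_diff : \forall z \near p,
  [/\ differentiable u z, differentiable mE z & differentiable mG z].
Proof.
case: C1u => du _; case: C1mE => dE _; case: C1mG => dG _.
by apply: filterS3 du dE dG.
Qed.

Let near_codazzi : \forall z \near p, 'D_(Y z) q z = q z * coef z.
Proof.
have /nbhs_interior near_good' := near_good.
near=> z.
have gz : nbhs z good by near: z; exact: near_good'.
have [du dE dG] : [/\ differentiable u z, differentiable mE z & differentiable mG z].
  by near: z.
have [Uz _ jz _] := nbhs_singleton gz.
have d (A : V -> E) : smooth U A -> differentiable A z.
  by move=> sA; exact: smooth_differentiable Uz.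
have [_ _ [MXz MYz] _ _] := good_frame _ (nbhs_singleton gz).
apply: (codazzi e1 e2 u mE mG u T1 T2 P1 P2 z _ (lam z)).
- exact (And4 du dE dG du).
- by split; try exact: d; apply: differentiable_addZ; exact: d.
- exact: P_comm.
- by apply: filterS gz => y /good_frame[].
- by apply: filterS gz => y /good_frame[].
- exact: MXz.
- exact: MYz.
- exact: jz.
Unshelve. all: by end_near. Qed.

Let near_q : \forall z \near p, {for z, continuous q} /\ derivable q z (Y z).
Proof.
near=> z.
have [Uz _ _ _] : good z by near: z.
have [du dE dG] : [/\ differentiable u z, differentiable mE z & differentiable mG z].
  by near: z.
have d (A : V -> E) : smooth U A -> differentiable A z.
  by move=> sA; exact: smooth_differentiable Uz.
have dP1 : differentiable P1 z by apply: differentiable_addZ; exact: d.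
have dP2 : differentiable P2 z by apply: differentiable_addZ; exact: d.
have dT1 := d _ sT1; have dT2 := d _ sT2.
split.
  by apply: continuous_inner; apply: continuous_comb; exact: differentiable_continuous.
have h1 := is_derive_comb _ u mE P1 P2 z (Y z) du dE dP1 dP2.
have h2 := is_derive_comb _ u mE T1 T2 z (Y z) du dE dT1 dT2.
exact: (@ex_derive _ _ _ _ _ _ _ (is_derive_inner _ _ _ _ _ _ h1 h2)).
Unshelve. all: by end_near. Qed.

Lemma zeros_of_q : q p = 0 -> limit_point [set z | q z = 0] p.
Proof.
move=> q0.
(* The height of the cone is measured by < D_e1 f p, D_v f p >, which is positive
   at v = Y p = u p e2 because F p > 0. *)
pose phi y := inner (cst (T1 p) y) (f y).
have dphi : differentiable phi p by apply: differentiable_inner => //; exact: df.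
have phiE v : 'd phi p v = inner (T1 p) ('D_v f p).
  rewrite -deriveE//.
  have h := is_derive_inner _ _ p v _ _ (is_derive_cst (T1 p) p v)
    (derivable_is_derive _ _ _ v (df _ Up)).
  rewrite (@derive_val _ _ _ _ _ _ _ h).
  by rewrite -[X in inner X _](scale0r (T1 p)) innerZl mul0r add0r.
apply: (zeros_cluster _ _ ('d phi p) q Y p (`|coef p| + 1)) => //.
- by move=> K; exact: bounded_closed_compact.
- exact: diff_continuous.
- by apply: continuous_comb => //; exact: cst_continuous.
- by rewrite phiE (TYE p Up) Y_p innerZr -/(Ff p) mulr_gt0// u_p addr_gt0.
- by apply: filterS near_q => z [].
- by apply: filterS near_q => z [].
have nb : \forall z \near p, `|coef z| <= `|coef p| + 1.
  by apply: (cvgr_norm_le _ ccoef); rewrite ltrDl.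
near=> z.
have -> : 'D_(Y z) q z = q z * coef z by near: z.
rewrite normrM mulrC ler_wpM2r//.
by near: z.
Unshelve. all: by end_near. Qed.

(** A zero of q is an umbilic or a quasi-umbilic, and p is the only umbilic
    in a neighbourhood. *)
Lemma quasi_umbilics_cluster : isolated_umbilic U f nu p ->
  limit_point [set x | U x /\ quasi_umbilic f nu x] p.
Proof.
move=> [up [U1 [pU1 _ _ iso]]] W pW.
have [_ _ _ uq _] := good_frame _ (nbhs_singleton near_good).
have WU : nbhs p (W `&` (good `&` U1)) by apply: filterI => //; exact: filterI.
have [z [zp qz [Wz [gz U1z]]]] := zeros_of_q (uq up) _ WU.
have [_ _ _ _ qu] := good_frame _ gz.
have qz' : quasi_umbilic f nu z.
  by apply: qu qz => /(iso _ U1z) zE; rewrite zE eqxx in zp.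
have [Uz _ _ _] := gz.
by exists z; exact: And3 zp (conj Uz qz') Wz.
Qed.

End Main.

Theorem mainTheorem1 (R : realType) (c : R) (U : set 'rV[R]_2)
    (f nu : 'rV[R]_2 -> 'rV[R]_(ambient_dim c)) (p : 'rV[R]_2)
    (U_open : open U) (U_connected : connected U)
    (f_timelike : timelike_immersion U f)
    (nu_normal : unit_normal U f nu)
    (f_cmc : exists H : R, forall x, U x -> mean_curvature f nu x = H)
    (pU : U p)
    (p_isolated : isolated_umbilic U f nu p) :
  limit_point [set x | U x /\ quasi_umbilic f nu x] p.
Proof.
have [H Hcst] := f_cmc.
have [_ _ _ /(_ p pU) lor] := f_timelike.
have [e1 [e2 [E0 G0 F0]]] := null_basis _ _ (immersion_diff _ _ f_timelike _ pU) lor.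
exact: (quasi_umbilics_cluster U f nu H e1 e2 p _ _ _ _ erefl erefl erefl erefl
  U_open f_timelike nu_normal Hcst pU E0 G0 F0 p_isolated).
Qed.
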